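(* Let $F$ be a non-degenerate distribution function with finite second moment belonging to the class NCP. If there exist a finite constant $C$ and a positive integer $k_0$ such that \[ \frac{\mathbb{E}[Z_k^2]}{k\,(\mathbb{E}[Z_k])^2}\le C\quad\text{for all }k\ge k_0, \] then the partial maxima BLUE $L_2^{(n)}$ of $\theta_2$ satisfies $\operatorname{Var}[L_2^{(n)}]=O(1/\log n)$ as $n\to\infty$.
   Context: For unknown $\theta_1\in\mathbb{R}$, $\theta_2>0$, $X_1^*,\dots,X_n^*$ are i.i.d. with distribution function $F((x-\theta_1)/\theta_2)$, $X^*_{j:j}=\max\{X_1^*,\dots,X_j^*\}$. Linear estimators are $\sum_i c_iX^*_{i:i}$ with constant $c_i$; $L_2^{(n)}$ is the linear estimator unbiased for $\theta_2$ for all $(\theta_1,\theta_2)$ with minimum variance. Let $X_1,X_2,\dots$ be i.i.d. from $F$, $X_{k:k}=\max\{X_1,\dots,X_k\}$, and $Z_k=X_{k+1:k+1}-X_{k:k}$, $k\ge1$. $F$ belongs to NCP if $\operatorname{Cov}[Z_i,Z_j]\le0$ for all positive integers $i\ne j$. *)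

(* Defs.v *)
From HB Require Import structures.
From mathcomp Require Import all_boot all_order all_algebra.
From mathcomp Require Import all_classical all_reals all_analysis.
Set Implicit Arguments. Unset Strict Implicit. Unset Printing Implicit Defensive.
Import Order.TTheory GRing.Theory Num.Theory.
Local Open Scope classical_set_scope.
Local Open Scope ring_scope.

(* X : nat -> T -> R is an i.i.d. sequence (X 0, X 1, ... play the role of
   X_1, X_2, ...) whose common distribution function is F. *)
Definition iid_with_cdf d (T : measurableType d) (R : realType)
  (P : probability T R) (X : nat -> T -> R) (F : R -> R) : Prop :=
  [/\ (forall i, measurable_fun setT (X i)),
      (forall i x, P [set w | X i w <= x] = (F x)%:E) &
      (forall (s : seq nat) (B : nat -> set R), uniq s ->
         (forall i, measurable (B i)) ->
         P (\bigcap_(i in [set j | j \in s]) (X i @^-1` B i)) =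
         (\prod_(i <- s) P (X i @^-1` B i))%E)].

Definition degenerate (R : realType) (F : R -> R) : Prop :=
  exists a : R, forall x, F x = if a <= x then 1 else 0.

Definition pmax (T : Type) (R : realType) (X : nat -> T -> R) (k : nat) : T -> R :=
  fun w => \big[Num.max/X 0%N w]_(i < k) X i w.

Definition Zgap (T : Type) (R : realType) (X : nat -> T -> R) (k : nat) : T -> R :=
  fun w => pmax X k.+1 w - pmax X k w.

Definition NCP d (T : measurableType d) (R : realType)
  (P : probability T R) (X : nat -> T -> R) : Prop :=
  forall i j : nat, (0 < i)%N -> (0 < j)%N -> i != j ->
    (covariance P (Zgap X i) (Zgap X j) <= 0)%E.

(* The sample X*_j = theta1 + theta2 X_j has distribution function
   F((x - theta1)/theta2); the linear estimator sum_{i=1}^n c_i X*_{i:i}. *)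
Definition lin_est (T : Type) (R : realType) (X : nat -> T -> R)
  (th1 th2 : R) (n : nat) (c : 'I_n -> R) : T -> R :=
  fun w => \sum_(i < n) c i * pmax (fun j w' => th1 + th2 * X j w') i.+1 w.

Definition unbiased_th2 d (T : measurableType d) (R : realType)
  (P : probability T R) (X : nat -> T -> R) (n : nat) (c : 'I_n -> R) : Prop :=
  forall th1 th2 : R, 0 < th2 -> ('E_P[lin_est X th1 th2 c] = th2%:E)%E.

Definition BLUE_th2 d (T : measurableType d) (R : realType)
  (P : probability T R) (X : nat -> T -> R) (n : nat) (c : 'I_n -> R) : Prop :=
  unbiased_th2 P X c /\
  forall (c' : 'I_n -> R), unbiased_th2 P X c' ->
  forall th1 th2 : R, 0 < th2 ->
    ('V_P[lin_est X th1 th2 c] <= 'V_P[lin_est X th1 th2 c'])%E.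

(* Main.v *)
Require Import Defs.
From HB Require Import structures.
From mathcomp Require Import all_boot all_order all_algebra.
From mathcomp Require Import all_classical all_reals all_analysis.
From mathcomp Require Import measurable_realfun ring lra.
Set Implicit Arguments. Unset Strict Implicit. Unset Printing Implicit Defensive.
Import Order.TTheory GRing.Theory Num.Theory.
Local Open Scope classical_set_scope.
Local Open Scope ring_scope.

(* Put m_k = E[Z_k] and H = sum_{k0 <= k < n} 1/k.  The estimator
   sum_{k0 <= k < n} b_k Z_k with b_k = 1/(k m_k H) is unbiased for theta_2.
   Since b_k >= 0, NCP bounds its variance by sum b_k^2 E[Z_k^2], and the moment
   hypothesis makes each term at most C/(k H^2), so the variance is at most
   C/H = O(1/log n).  Non-degeneracy gives m_k > 0.  The BLUE exists because a
   positive semidefinite quadratic form attains its minimum on any affine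
   subspace. *)

(** * Minimising a positive semidefinite quadratic form *)

Definition quadf (R : realFieldType) n (S : 'M[R]_n) (x : 'rV[R]_n) : R :=
  (x *m S *m x^T) 0 0.

Lemma quadfD (R : realFieldType) n (S : 'M[R]_n) (x h : 'rV[R]_n) :
  S^T = S ->
  quadf S (x + h) = quadf S x + 2 * (x *m S *m h^T) 0 0 + quadf S h.
Proof.
move=> symS.
have mxD (a b : 'M[R]_1) : (a + b) 0 0 = a 0 0 + b 0 0 by rewrite mxE.
rewrite /quadf linearD/= mulmxDr !mulmxDl !mxD.
have -> : (h *m S *m x^T) 0 0 = (x *m S *m h^T) 0 0.
  rewrite -[in LHS](trmxK (h *m S *m x^T)) mxE.
  by rewrite !trmx_mul trmxK symS mulmxA.
by ring.
Qed.

Lemma quadfZ (R : realFieldType) n (S : 'M[R]_n) t (x : 'rV[R]_n) :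
  quadf S (t *: x) = t ^+ 2 * quadf S x.
Proof.
by rewrite /quadf linearZ/= -!scalemxAl -!scalemxAr scalerA mxE -expr2.
Qed.

(** Along the line [x + t *: u] the form is affine in [t] with slope [2 * (x *m S *m u^T) 0 0], so
    nonnegativity forces this slope to vanish; taking basis vectors for [x] gives every entry of
    [S *m u^T]. *)
Lemma psd_isotropic (R : realFieldType) n (S : 'M[R]_n) (u : 'rV[R]_n) :
  S^T = S -> (forall x, 0 <= quadf S x) -> quadf S u = 0 -> S *m u^T = 0.
Proof.
move=> symS psdS qu0; apply/row_matrixP => i; rewrite row0 row_mul rowE.
set x := delta_mx 0 i; apply/rowP => j; rewrite ord1 !mxE.
have [|b0] := eqVneq ((x *m S *m u^T) 0 0) 0; first by rewrite mxE.
set b := (x *m S *m u^T) 0 0 in b0.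
(* The multiple of [u] is chosen so that the form takes the value -1 there. *)
have := psdS (x + (- (quadf S x + 1) / (2 * b)) *: u).
rewrite quadfD// quadfZ qu0 mulr0 addr0 linearZ/= -scalemxAr mxE -/b.
have -> : quadf S x + 2 * (- (quadf S x + 1) / (2 * b) * b) = - 1 by field.
by rewrite ler0N1.
Qed.

(** The admissible points are [v + k *m N], with [N] spanning the left kernel of [A]. The minimiser
    is the one that is [S]-orthogonal to the rows of [N]: moving away from it along the kernel adds
    only the nonnegative term [quadf S (k *m N)]. *)
Lemma psd_affine_min (R : realFieldType) n m (S : 'M[R]_n) (A : 'M[R]_(n, m))
    (v : 'rV[R]_n) :
  S^T = S -> (forall x, 0 <= quadf S x) ->
  exists2 w, w *m A = v *m A &
    forall x, x *m A = v *m A -> quadf S w <= quadf S x.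
Proof.
move=> symS psdS; pose N := kermx A.
have NA : N *m A = 0 by exact: mulmx_ker.
have subN (x : 'rV_n) : x *m A = 0 -> exists k, x = k *m N.
  by move=> xA0; apply/submxP/sub_kermxP.
move: N NA subN => N NA subN; pose M := N *m S *m N^T.
have : (v *m S *m N^T <= M)%MS.
  (* The normal equations y M = v S N^T are solvable even for singular S: a
     vector z with M z = 0 makes N^T z isotropic, hence S N^T z = 0. *)
  rewrite submxE; move: (cokermx M) (mulmx_coker M) => K MK.
  suff : S *m N^T *m K = 0 by rewrite -!mulmxA => ->; rewrite mulmx0.
  apply: trmx_inj; apply/row_matrixP => j; rewrite trmx0 row0.
  have KMK : K^T *m M *m K = 0 by rewrite -mulmxA MK mulmx0.
  have uE : row j (K^T *m N) *m S *m (row j (K^T *m N))^T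
            = (K^T *m M *m K) j j *: 1%:M.
    apply/matrixP => a b; rewrite !ord1 tr_row trmx_mul trmxK.
    have rowcol p q r (B : 'M[R]_(p, q)) (D : 'M[R]_(q, r)) i k :
        (row i B *m col k D) 0 0 = (B *m D) i k.
      by rewrite !mxE; apply: eq_bigr => l _; rewrite !mxE.
    by rewrite -row_mul rowcol [RHS]mxE [X in _ * X]mxE mulr1 /M !mulmxA.
  have := psd_isotropic symS psdS (u := row j (K^T *m N)).
  rewrite /quadf uE KMK !mxE mul0r => /(_ erefl) /(congr1 trmx) uS.
  move: uS; rewrite trmx0 [in X in X -> _]trmx_mul trmxK symS -row_mul => uS.
  by rewrite !trmx_mul trmxK symS mulmxA.
move=> /submxP[y yE]; have wN : (v - y *m N) *m S *m N^T = 0.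
  by rewrite mulmxBl mulmxBl yE /M !mulmxA subrr.
exists (v - y *m N); first by rewrite mulmxBl -mulmxA NA mulmx0 subr0.
move=> x xA; have [|k kE] := subN (x - (v - y *m N)).
  by rewrite mulmxBl xA mulmxBl -mulmxA NA mulmx0 subr0 subrr.
have -> : x = v - y *m N + k *m N by rewrite -kE addrC subrK.
rewrite [leRHS]quadfD// trmx_mul mulmxA wN mul0mx.
by rewrite mxE mulr0 addr0 lerDl psdS.
Qed.

(** * Square integrability, partial maxima and their gaps *)

Lemma Lfun2_sqr_lty d (T : measurableType d) (R : realType)
    (mu : {measure set T -> \bar R}) (f : T -> R) :
  measurable_fun setT f -> (\int[mu]_w (f w ^+ 2)%:E < +oo)%E ->
  f \in Lfun mu 2%:E.
Proof.
move=> mf f2; rewrite inE; apply/andP; split; rewrite inE//=.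
rewrite /finite_norm unlock /Lnorm poweR_lty//.
under eq_integral => x _ do rewrite /= powR_mulrn// real_normK ?num_real//.
exact: f2.
Qed.

(** The square of the maximum is one of the two squares, hence at most their sum. *)
Lemma Lfun2_max d (T : measurableType d) (R : realType)
    (mu : {measure set T -> \bar R}) (f g : T -> R) :
  f \in Lfun mu 2%:E -> g \in Lfun mu 2%:E ->
  (fun w => Num.max (f w) (g w)) \in Lfun mu 2%:E.
Proof.
move=> f2 g2.
have mf : measurable_fun setT f by exact/set_mem/(sub_Lfun_mfun f2).
have mg : measurable_fun setT g by exact/set_mem/(sub_Lfun_mfun g2).
apply: Lfun2_sqr_lty; first exact: measurable_maxr.
have /integrableP[mf2 _] := Lfun2_integrable_sqr f2.
have /integrableP[mg2 _] := Lfun2_integrable_sqr g2.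
apply: (@le_lt_trans _ _ (\int[mu]_w ((f w ^+ 2)%:E + (g w ^+ 2)%:E)%E)%E).
  apply: ge0_le_integral => //=.
  - by move=> x _; rewrite lee_fin sqr_ge0.
  - apply/measurable_EFinP; apply: measurable_funX; exact: measurable_maxr.
  - by apply: emeasurable_funD.
  - move=> x _; rewrite -EFinD lee_fin.
    by case: (leP (f x) (g x)) => _; rewrite ?lerDl ?lerDr sqr_ge0.
rewrite integralD//; [|exact: Lfun2_integrable_sqr..].
rewrite lte_add_pinfty//; apply: integrable_lty => //;
  exact: Lfun2_integrable_sqr.
Qed.

(** The clause on [X 0] comes from the seed of the iterated maximum. It adds something only for
    [k = 0], where the maximum is [X 0] itself. *)
Lemma pmax_leP (T : Type) (R : realType) (X : nat -> T -> R) k w y :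
  reflect (X 0%N w <= y /\ forall i, (i < k)%N -> X i w <= y) (pmax X k w <= y).
Proof.
apply: (iffP (bigmax_leP _ _ _ _)) => -[X0 Xi]; split=> // i.
  by move=> ik; exact: (Xi (Ordinal ik)).
by move=> _; exact: Xi.
Qed.

Lemma pmax0 (T : Type) (R : realType) (X : nat -> T -> R) : pmax X 0 = X 0%N.
Proof. by apply/funext => w; rewrite /pmax big_ord0. Qed.

Lemma pmaxS (T : Type) (R : realType) (X : nat -> T -> R) k :
  pmax X k.+1 = fun w => Num.max (pmax X k w) (X k w).
Proof.
apply/funext => w; apply/le_anti/andP; split.
  apply/pmax_leP; split=> [|i]; rewrite le_max.
    by apply/orP; left; have /pmax_leP[] := lexx (pmax X k w).
  rewrite ltnS leq_eqVlt => /predU1P[->|ik]; first by rewrite lexx orbT.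
  by apply/orP; left; have /pmax_leP[_ ->] := lexx (pmax X k w).
have /pmax_leP[X0 Xi] := lexx (pmax X k.+1 w).
rewrite ge_max Xi ?leqnn// andbT.
by apply/pmax_leP; split=> // i ik; apply: Xi; rewrite ltnW.
Qed.

Lemma pmax_affine (T : Type) (R : realType) (X : nat -> T -> R) (a b : R) k w :
  0 < b -> pmax (fun j v => a + b * X j v) k w = a + b * pmax X k w.
Proof.
move=> b0; elim: k => [|k IHk]; first by rewrite !pmax0.
by rewrite !pmaxS IHk -addr_maxr maxr_pMr// ltW.
Qed.

Lemma Lfun2_pmax d (T : measurableType d) (R : realType)
    (mu : {measure set T -> \bar R}) (X : nat -> T -> R) k :
  (forall i, X i \in Lfun mu 2%:E) -> pmax X k \in Lfun mu 2%:E.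
Proof.
by move=> X2; elim: k => [|k IHk]; rewrite ?pmax0// pmaxS Lfun2_max.
Qed.

Lemma Zgap_ge0 (T : Type) (R : realType) (X : nat -> T -> R) k w :
  0 <= Zgap X k w.
Proof. by rewrite subr_ge0 pmaxS le_max lexx. Qed.

(** Summation by parts: it turns a combination of gaps into a combination of maxima, up to boundary
    terms that vanish when [b] is zero at [0] and at [n]. *)
Lemma abel_Zgap (T : Type) (R : realType) (X : nat -> T -> R) (b : nat -> R) n w :
  \sum_(i < n) (b i - b i.+1) * pmax X i.+1 w =
  \sum_(i < n) b i * Zgap X i w - b n * pmax X n w + b 0%N * pmax X 0 w.
Proof.
elim: n => [|n IHn]; first by rewrite !big_ord0; ring.
by rewrite !big_ord_recr/= IHn /Zgap; ring.
Qed.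

(** * Consequences of the common distribution function *)

(** The open right half-lines are stable under intersection and generate the Borel sets, and the two
    laws agree on them because each mass is one minus the distribution function. *)
Lemma eq_cdf_distribution d (T : measurableType d) (R : realType)
    (P : probability T R) (X Y : {RV P >-> R}) :
  (forall x, cdf X x = cdf Y x) ->
  forall A, measurable A -> distribution P X A = distribution P Y A.
Proof.
move=> XY A mA.
apply: (@g_sigma_algebra_measure_unique _ R _ (@RGenOInfty.G R) _
  (fun n => `]- n%:R, +oo[%classic)).
- by move=> _ [x ->].
- by move=> n; exists (- n%:R).
- apply/seteqP; split=> // x _.
  exists (Num.bound `|x|) => //=; rewrite in_itv/= andbT ltrNl.
  rewrite (le_lt_trans _ (archi_boundP _))// -normrN; exact: ler_norm.
- move=> _ _ [x ->] [y ->]; exists (Num.max x y).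
  apply/seteqP; split=> z; rewrite /= !in_itv/= !andbT gt_max.
    by case=> -> ->.
  by move=> /andP.
- by move=> _ [x ->]; have := ccdf_1_cdf X x; rewrite XY -ccdf_1_cdf.
- by move=> n; rewrite (le_lt_trans (probability_le1 _ _)) ?ltry.
- exact: (eq_ind _ (fun S => S A) mA _ (RGenOInfty.measurableE R)).
Qed.

(** The moment assumption concerns [X 0] only; equality of laws carries it to every [X i], by
    integrating the square against the image measure. *)
Lemma iid_Lfun2 d (T : measurableType d) (R : realType) (P : probability T R)
    (X : nat -> T -> R) (F : R -> R) :
  iid_with_cdf P X F -> ('E_P[(fun w => (X 0%N w ^+ 2)%R)] < +oo)%E ->
  forall i, X i \in Lfun P 2%:E.
Proof.
move=> [mX XF _] X02 i; apply: Lfun2_sqr_lty => //.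
move: X02; rewrite unlock; apply: le_lt_trans; rewrite le_eqVlt; apply/orP; left.
apply/eqP.
pose rv j : {RV P >-> R} := HB.pack (X j) (isMeasurableFun.Build _ _ _ _ _ (mX j)).
have law : forall A, measurable A ->
    distribution P (rv i) A = distribution P (rv 0%N) A.
  apply: eq_cdf_distribution => x; rewrite /cdf /distribution /pushforward/=.
  have pre j : X j @^-1` `]-oo, x] = [set w | X j w <= x].
    by apply/seteqP; split => w; rewrite /= in_itv.
  by rewrite !pre !XF.
have msqr : measurable_fun [set: R] (fun y : R => (y ^+ 2)%:E).
  by apply/measurable_EFinP; exact: measurable_funX.
have sqr0 (y : R) : (0 <= (y ^+ 2)%:E)%E by rewrite lee_fin sqr_ge0.
transitivity (\int[distribution P (rv i)]_y (y ^+ 2)%:E)%E.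
  by rewrite ge0_integral_distribution.
transitivity (\int[distribution P (rv 0%N)]_y (y ^+ 2)%:E)%E.
  by apply: eq_measure_integral => A mA _; exact: law.
by rewrite ge0_integral_distribution.
Qed.

(** By contraposition: a distribution function with values in {0, 1} jumps once, at the infimum of
    the set where it equals 1, and is therefore degenerate. *)
Lemma nondegenerate_cdf d (T : measurableType d) (R : realType)
    (P : probability T R) (Y : {RV P >-> R}) (F : R -> R) :
  (forall x, cdf Y x = (F x)%:E) -> ~ degenerate F ->
  exists x, 0 < F x < 1.
Proof.
move=> YF; apply: contra_notP => noF.
have F01 x : F x = 0 \/ F x = 1.
  have F0 : 0 <= F x by rewrite -lee_fin -YF cdf_ge0.
  have F1 : F x <= 1 by rewrite -lee_fin -YF cdf_le1.
  move: F0 F1; rewrite !le_eqVlt => /predU1P[->|F0]; first by left.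
  by move=> /predU1P[->|F1]; [right|case: noF; exists x; rewrite F0].
have Fnd x y : x <= y -> F x <= F y.
  by move=> xy; rewrite -lee_fin -!YF; exact: cdf_nondecreasing.
have FE : cdf Y = EFin \o F by apply/funext => x; rewrite YF.
(* The limits 1 and 0 at the two infinities show that both values are attained, so [S] below is
   nonempty and bounded below. *)
have [u Fu] : exists u, F u = 1.
  have := @cvg_cdfy1 _ _ _ _ Y; rewrite FE => /fine_cvgP[_] /cvgr_gt.
  move=> /(_ _ ltr01)[M [_ MF]]; exists (M + 1).
  have /= := MF (M + 1); rewrite ltrDl ltr01 => /(_ isT).
  by case: (F01 (M + 1)) => -> //; rewrite ltxx.
have [l Fl] : exists l, F l = 0.
  have := @cvg_cdfNy0 _ _ _ _ Y; rewrite FE => /fine_cvgP[_] /cvgr_lt.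
  move=> /(_ _ ltr01)[M [_ MF]]; exists (M - 1).
  have /= := MF (M - 1); rewrite ltrBlDr ltrDl ltr01 => /(_ isT).
  by case: (F01 (M - 1)) => -> //; rewrite ltxx.
pose S := [set x | F x = 1].
have lbS : lbound S l.
  move=> x Fx; rewrite leNgt; apply/negP => xl.
  by have := Fnd _ _ (ltW xl); rewrite Fx Fl ler10.
have infS : has_inf S by split; [exists u|exists l].
exists (inf S) => x; case: leP => [Sx|xS].
  have Fgt y : inf S < y -> F y = 1.
    move=> Sy; have [z Fz zy] := inf_lt (proj1 infS) Sy.
    by case: (F01 y) => // Fy; have := Fnd _ _ (ltW zy); rewrite Fz Fy ler10.
  move: Sx; rewrite le_eqVlt => /predU1P[<-|]; last exact: Fgt.
  (* Right continuity settles the value at the jump: [F] is 1 immediately to the right of [inf S],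
     hence also at [inf S]. *)
  have := @cdf_right_continuous _ _ _ _ Y (inf S); rewrite FE => Frc.
  have : cst 1%E z @[z --> (inf S)^'+] --> (F (inf S))%:E.
    apply: cvg_trans Frc; apply: near_eq_cvg; near=> z.
    by rewrite /= Fgt.
  move=> /(cvg_unique (@ereal_hausdorff R) (cvg_cst _)).
  by case=> /esym.
case: (F01 x) => [//|Fx].
by have := ge_inf (proj2 infS) Fx; rewrite leNgt xS.
Unshelve. all: by end_near. Qed.

(** * Moments of finite linear combinations *)

Section L2.
Context d (T : measurableType d) (R : realType) (P : probability T R).

Lemma Lfun2_Lfun1 (Y : T -> R) : Y \in Lfun P 2%:E -> Y \in Lfun P 1.
Proof. exact/Lfun_subset12/fin_num_measure. Qed.

Lemma Lfun2_lincomb (I : Type) (r : seq I) (a : I -> R) (Y : I -> T -> R) :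
  (forall i, Y i \in Lfun P 2%:E) ->
  (fun w => \sum_(i <- r) a i * Y i w) \in Lfun P 2%:E.
Proof.
move=> Y2; elim: r => [|i r IHr].
  under eq_fun do rewrite big_nil.
  exact: (Lfun_cst P 0).
have -> : (fun w => \sum_(j <- i :: r) a j * Y j w) =
    (a i \o* Y i) \+ (fun w => \sum_(j <- r) a j * Y j w).
  by apply/funext => w; rewrite big_cons /= (mulrC (Y i w)).
have aY : a i \o* Y i \in Lfun P 2%:E by apply: Lfun_scale; rewrite ?ler1n.
by rewrite rpredD ?lee1n.
Qed.

Lemma expectation_lincomb (I : Type) (r : seq I) (a : I -> R) (Y : I -> T -> R) :
  (forall i, Y i \in Lfun P 2%:E) ->
  ('E_P[fun w => (\sum_(i <- r) a i * Y i w)%R] =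
   (\sum_(i <- r) a i * fine 'E_P[Y i])%:E)%E.
Proof.
move=> Y2; elim: r => [|i r IHr].
  under eq_fun do rewrite big_nil.
  by rewrite big_nil; exact: expectation_cst.
have -> : (fun w => \sum_(j <- i :: r) a j * Y j w) =
    (a i \o* Y i) \+ (fun w => \sum_(j <- r) a j * Y j w).
  by apply/funext => w; rewrite big_cons /= (mulrC (Y i w)).
have Yi1 := Lfun2_Lfun1 (Y2 i).
rewrite expectationD; [|exact: Lfun_scale|exact/Lfun2_Lfun1/Lfun2_lincomb].
rewrite expectationZl// IHr big_cons EFinD EFinM fineK//.
exact: expectation_fin_num.
Qed.

Lemma covariance_lincombl (I : Type) (r : seq I) (a : I -> R) (Y : I -> T -> R)
    (Z : T -> R) : (forall i, Y i \in Lfun P 2%:E) -> Z \in Lfun P 2%:E ->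
  covariance P (fun w => \sum_(i <- r) a i * Y i w) Z =
  (\sum_(i <- r) a i * fine (covariance P (Y i) Z))%:E.
Proof.
move=> Y2 Z2; elim: r => [|i r IHr].
  under eq_fun do rewrite big_nil.
  by rewrite big_nil; exact: covariance_cst_l.
have -> : (fun w => \sum_(j <- i :: r) a j * Y j w) =
    (a i \o* Y i) \+ (fun w => \sum_(j <- r) a j * Y j w).
  by apply/funext => w; rewrite big_cons /= (mulrC (Y i w)).
have Yi1 := Lfun2_Lfun1 (Y2 i); have Z1 := Lfun2_Lfun1 Z2.
have YZ1 := Lfun2_mul_Lfun1 (Y2 i) Z2.
rewrite covarianceDl//; [|by apply: Lfun_scale; rewrite ?ler1n|exact: Lfun2_lincomb].
rewrite covarianceZl// IHr big_cons EFinD EFinM fineK//.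
exact: covariance_fin_num.
Qed.

Lemma covariance_lincomb (I J : Type) (r : seq I) (s : seq J) (a : I -> R)
    (b : J -> R) (Y : I -> T -> R) (Z : J -> T -> R) :
  (forall i, Y i \in Lfun P 2%:E) -> (forall j, Z j \in Lfun P 2%:E) ->
  covariance P (fun w => \sum_(i <- r) a i * Y i w)
               (fun w => \sum_(j <- s) b j * Z j w) =
  (\sum_(i <- r) \sum_(j <- s) a i * b j * fine (covariance P (Y i) (Z j)))%:E.
Proof.
move=> Y2 Z2; rewrite covariance_lincombl//; last exact: Lfun2_lincomb.
congr EFin; apply: eq_bigr => i _; rewrite covarianceC covariance_lincombl//=.
by rewrite mulr_sumr; apply: eq_bigr => j _; rewrite covarianceC mulrA.
Qed.

Lemma fine_variance_le_sqr (Z : T -> R) : Z \in Lfun P 2%:E ->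
  fine 'V_P[Z] <= fine 'E_P[fun w => (Z w ^+ 2)%R].
Proof.
move=> Z2; have Z1 := Lfun2_Lfun1 Z2; have Zfin := expectation_fin_num Z1.
have ZZfin : ('E_P[fun w => (Z w ^+ 2)%R])%E \is a fin_num.
  exact/expectation_fin_num/(Lfun2_mul_Lfun1 Z2 Z2).
rewrite varianceE// -(fineK Zfin) -EFin_expe fineB//.
by rewrite gerBl sqr_ge0.
Qed.

End L2.

(** * Positivity of the mean gaps *)

(** With 0 < F(x) < 1, independence gives probability F(x)^k (1 - F(x)) > 0 to the event that the
    first [k] variables are at most [x] and the next one exceeds [x]. The gap is positive on that
    event, so its mean cannot vanish. *)
Lemma expectation_Zgap_gt0 d (T : measurableType d) (R : realType)
    (P : probability T R) (X : nat -> T -> R) (F : R -> R) k :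
  iid_with_cdf P X F -> (forall i, X i \in Lfun P 2%:E) ->
  (exists x, 0 < F x < 1) -> (0 < k)%N -> 0 < fine 'E_P[Zgap X k].
Proof.
move=> [mX XF Xind] X2 [x /andP[Fx0 Fx1]] k0.
have mZ : measurable_fun setT (Zgap X k).
  apply: measurable_funB;
    by apply/set_mem/(@sub_Lfun_mfun _ _ _ P 2%:E)/Lfun2_pmax.
have Zfin : ('E_P[Zgap X k])%E \is a fin_num.
  by apply/expectation_fin_num; rewrite rpredB ?Lfun2_Lfun1 ?Lfun2_pmax.
rewrite lt0r fine_ge0 ?andbT; last first.
  by apply: expectation_ge0 => w; exact: Zgap_ge0.
apply/eqP => EZ0.
pose B i : set R := if (i < k)%N then `]-oo, x]%classic else `]x, +oo[%classic.
have mB i : measurable (B i) by rewrite /B; case: ifP.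
pose A := \bigcap_(i in [set j | j \in iota 0 k.+1]) (X i @^-1` B i).
have pre_le i : X i @^-1` `]-oo, x] = [set w | X i w <= x].
  by apply/seteqP; split => w; rewrite /= in_itv.
have mXB i : measurable (X i @^-1` B i).
  by rewrite -[X in measurable X]setTI; exact: mX.
have PXB i : (0 < P (X i @^-1` B i))%E.
  rewrite /B; case: ifP => _; first by rewrite pre_le XF lte_fin.
  have -> : X i @^-1` `]x, +oo[ = ~` (X i @^-1` `]-oo, x]).
    by apply/seteqP; split => w; rewrite /= !in_itv/= andbT ltNge => /negP.
  rewrite pre_le probability_setC.
    by rewrite XF -EFinB lte_fin subr_gt0.
  by rewrite -pre_le -[X in measurable X]setTI; exact: mX.
have PA : (0 < P A)%E.
  rewrite Xind ?iota_uniq//.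
  apply: (big_ind (fun z => 0 < z)%E) => //; exact: mule_gt0.
have mA : measurable A by apply: bigcap_measurableType.
(* A nonnegative function with zero integral vanishes almost everywhere; the event [A] would then
   lie in a null set. *)
have : ae_eq P setT (EFin \o Zgap X k) (cst 0%E).
  apply/ae_eq_integral_abs => //; first exact/measurable_EFinP.
  rewrite -[RHS](_ : ('E_P[Zgap X k])%E = _); last by rewrite -(fineK Zfin) EZ0.
  rewrite unlock; apply: eq_integral => w _.
  by rewrite /= ger0_norm// Zgap_ge0.
move=> [N [mN PN0 AN]]; move: PA; apply/negP; rewrite -leNgt -PN0.
apply: le_measure; rewrite ?inE// => w Aw; apply: AN => /= /(_ Logic.I) /= [].
apply/eqP; rewrite gt_eqF// subr_gt0 pmaxS lt_max; apply/orP; right.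
have Xk : x < X k w.
  have : (X k @^-1` B k) w by apply: Aw; rewrite /mkset mem_iota add0n ltnSn.
  by rewrite /B ltnn /= in_itv/= andbT.
apply: le_lt_trans Xk.
have Xi i : (i < k)%N -> X i w <= x.
  move=> ik; have : (X i @^-1` B i) w.
    by apply: Aw; rewrite /mkset mem_iota add0n ltnS (ltnW ik).
  by rewrite /B ik /= in_itv.
by apply/pmax_leP; split; [exact: Xi|].
Qed.

(** * Harmonic sums and the logarithm *)

Definition harmonic_tail (R : realType) (m n : nat) : R :=
  \sum_(m <= k < n) k%:R^-1.

(** The left side telescopes into the terms ln(1 + 1/k), each at most 1/k. *)
Lemma ln_le_harmonic_tail (R : realType) (m n : nat) : (0 < m)%N -> (m <= n)%N ->
  ln n%:R - ln m%:R <= harmonic_tail R m n.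
Proof.
move=> m0 mn; rewrite -(telescope_sumr (fun k => ln (k%:R : R)) mn).
apply: ler_sum_nat => k /andP[mk _].
have k0' : (0 < k)%N by exact: leq_trans mk.
have k0 : 0 < (k%:R : R) by rewrite ltr0n.
have -> : ln (k.+1%:R : R) - ln k%:R = ln (1 + k%:R^-1).
  rewrite -ln_div ?posrE ?ltr0n//.
  by rewrite -[in k.+1%:R]natr1 mulrDl mul1r divff ?gt_eqF.
by apply: le_ln1Dx; rewrite (@lt_trans _ _ 0) ?ltrN10 ?invr_gt0.
Qed.

(** The condition on [n] makes ln m at most half of ln n, which absorbs the constant subtracted in
    the previous bound. *)
Lemma half_ln_le_harmonic_tail (R : realType) (m n : nat) :
  (0 < m)%N -> (m ^ 2 <= n)%N -> ln (n%:R : R) / 2 <= harmonic_tail R m n.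
Proof.
move=> m0 mn.
have mn' : (m <= n)%N by apply: leq_trans mn; rewrite -{1}(expn1 m) leq_pexp2l.
apply: le_trans (ln_le_harmonic_tail R m0 mn').
suff : ln (m%:R : R) *+ 2 <= ln n%:R by rewrite mulr2n; lra.
rewrite -lnXn ?ltr0n// ler_ln ?posrE ?exprn_gt0 ?ltr0n ?(leq_trans m0)//.
by rewrite -natrX ler_nat.
Qed.

(** * Linear estimators and existence of the BLUE *)

Section linear_estimators.
Context d (T : measurableType d) (R : realType) (P : probability T R)
  (X : nat -> T -> R).
Hypothesis X2 : forall i, X i \in Lfun P 2%:E.

Let Y (i : nat) := pmax X i.+1.
Let Y2 i : Y i \in Lfun P 2%:E. Proof. exact: Lfun2_pmax. Qed.

(** This is the estimator at the standard parameters [th1 = 0], [th2 = 1], to which the general case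
    reduces by an affine change. *)
Definition max_comb n (c : 'I_n -> R) : T -> R :=
  fun w => \sum_(i < n) c i * pmax X i.+1 w.

Definition max_cov n : 'M[R]_n :=
  \matrix_(i, j) fine (covariance P (pmax X i.+1) (pmax X j.+1)).

(** The two columns encode unbiasedness as a linear system with right-hand side (0, 1): the
    coefficients sum to zero, and their combination of the mean maxima is one. *)
Definition max_constraints n : 'M[R]_(n, 2) :=
  \matrix_(i, j) if j == 0 then 1 else fine 'E_P[pmax X i.+1].

Lemma max_comb_Lfun2 n (c : 'I_n -> R) : max_comb c \in Lfun P 2%:E.
Proof. exact: (Lfun2_lincomb _ _ (fun i : 'I_n => Y2 i)). Qed.

Lemma lin_estE n (c : 'I_n -> R) th1 th2 : 0 < th2 ->
  lin_est X th1 th2 c =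
  cst (th1 * \sum_(i < n) c i) \+ th2 \o* max_comb c.
Proof.
move=> th20; apply/funext => w; rewrite /lin_est /max_comb /=.
rewrite mulr_sumr mulr_suml -big_split/=; apply: eq_bigr => i _.
by rewrite pmax_affine//; ring.
Qed.

Lemma expectation_lin_est n (c : 'I_n -> R) th1 th2 : 0 < th2 ->
  ('E_P[lin_est X th1 th2 c] =
   (th1 * \sum_(i < n) c i +
    th2 * \sum_(i < n) c i * fine 'E_P[pmax X i.+1])%R%:E)%E.
Proof.
move=> th20; rewrite lin_estE// expectationD.
- rewrite expectation_cst expectationZl; last exact/Lfun2_Lfun1/max_comb_Lfun2.
  by rewrite (expectation_lincomb _ _ (fun i : 'I_n => Y2 i)) -EFinM -EFinD.
- exact: Lfun_cst.
- by apply: Lfun_scale => //; exact/Lfun2_Lfun1/max_comb_Lfun2.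
Qed.

(** Since the parameters enter only through a positive factor, one minimiser serves all of them at
    once. *)
Lemma variance_lin_est n (c : 'I_n -> R) th1 th2 : 0 < th2 ->
  ('V_P[lin_est X th1 th2 c] = (th2 ^+ 2)%:E * 'V_P[max_comb c])%E.
Proof.
move=> th20; have c2 := max_comb_Lfun2 c.
rewrite lin_estE// varianceD_cst_l ?varianceZ//.
by apply: Lfun_scale; rewrite ?ler1n.
Qed.

Lemma variance_max_comb n (c : 'I_n -> R) :
  ('V_P[max_comb c] = (quadf (max_cov n) (\row_i c i))%:E)%E.
Proof.
rewrite /variance (covariance_lincomb _ _ _ _ (fun i : 'I_n => Y2 i)
  (fun i : 'I_n => Y2 i)) /quadf; congr EFin.
rewrite mxE exchange_big/=; apply: eq_bigr => j _.
rewrite !mxE mulr_suml; apply: eq_bigr => i _.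
by rewrite !mxE; ring.
Qed.

Lemma unbiased_th2P n (c : 'I_n -> R) :
  unbiased_th2 P X c <->
  \sum_(i < n) c i = 0 /\ \sum_(i < n) c i * fine 'E_P[pmax X i.+1] = 1.
Proof.
split=> [unb|[c0 c1] th1 th2 th20]; last first.
  by rewrite expectation_lin_est// c0 c1 mulr0 add0r mulr1.
(* The mean is linear in the parameters: (0, 1) yields the second equation, and comparison with (1,
   1) yields the first. *)
have := unb 0 1 ltr01; rewrite expectation_lin_est// mul0r add0r mul1r => -[c1].
have := unb 1 1 ltr01; rewrite expectation_lin_est// c1 !mul1r => -[].
by move=> /(canRL (addrK _)); rewrite subrr.
Qed.

Lemma unbiased_th2_constraints n (c : 'I_n -> R) :
  unbiased_th2 P X c <->
  (\row_i c i) *m max_constraints n = \row_(j < 2) (val j)%:R.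
Proof.
have E0 : ((\row_i c i) *m max_constraints n) 0 0 = \sum_(i < n) c i.
  by rewrite mxE; apply: eq_bigr => i _; rewrite !mxE mulr1.
have E1 : ((\row_i c i) *m max_constraints n) 0 1 =
    \sum_(i < n) c i * fine 'E_P[pmax X i.+1].
  by rewrite mxE; apply: eq_bigr => i _; rewrite !mxE.
split=> [/unbiased_th2P[c0 c1]|cE].
  apply/rowP => j; case: (unliftP 0 j) => [k|] ->; last by rewrite E0 c0 mxE.
  by rewrite ord1 (_ : lift 0 0 = 1) ?E1 ?c1 ?mxE//; apply/val_inj.
by apply/unbiased_th2P; rewrite -E0 -E1 cE !mxE.
Qed.

(** Unbiasedness cuts out an affine subspace, nonempty thanks to [c0], and the covariance form is
    positive semidefinite because its values are variances. *)
Lemma BLUE_th2_exists n (c0 : 'I_n -> R) : unbiased_th2 P X c0 ->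
  exists c : 'I_n -> R, BLUE_th2 P X c.
Proof.
move=> c0U; pose S := max_cov n.
have symS : S^T = S by apply/matrixP => i j; rewrite !mxE covarianceC.
have psdS x : 0 <= quadf S x.
  rewrite -lee_fin (_ : x = \row_i x 0 i); last by apply/rowP => i; rewrite mxE.
  by rewrite -variance_max_comb variance_ge0.
have [w wA wmin] := psd_affine_min (max_constraints n) (\row_i c0 i) symS psdS.
have wE : w = \row_i w 0 i by apply/rowP => i; rewrite mxE.
exists (fun i => w 0 i); split.
  by apply/unbiased_th2_constraints; rewrite -wE wA; apply/unbiased_th2_constraints.
move=> c cU th1 th2 th20; rewrite !variance_lin_est// !variance_max_comb -wE.
rewrite -!EFinM lee_fin ler_pM2l ?exprn_gt0//; apply: wmin.
by move: cU c0U => /unbiased_th2_constraints-> /unbiased_th2_constraints->.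
Qed.

End linear_estimators.

(** * The explicit estimator built from gaps *)

Section gap_weights.
Context d (T : measurableType d) (R : realType) (P : probability T R)
  (X : nat -> T -> R).
Hypothesis X2 : forall i, X i \in Lfun P 2%:E.

Let m k := fine 'E_P[Zgap X k].

Lemma Zgap_Lfun2 k : Zgap X k \in Lfun P 2%:E.
Proof. by rewrite rpredB ?lee1n// => ?; exact: Lfun2_pmax. Qed.

(** Vanishing outside the range removes the boundary terms of the summation by parts and, when [k0]
    is positive, the index 0, which NCP does not cover. *)
Definition gap_weight (k0 n k : nat) : R :=
  if (k0 <= k < n)%N then (k%:R * m k * harmonic_tail R k0 n)^-1 else 0.

(** Index [i] carries the coefficient of [pmax X i.+1] after summation by parts, hence this order of
    the difference. *)
Definition gap_coef (k0 n : nat) (i : 'I_n) : R :=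
  gap_weight k0 n i - gap_weight k0 n i.+1.

Lemma gap_weight0 k0 n : (0 < k0)%N -> gap_weight k0 n 0 = 0.
Proof. by rewrite /gap_weight leqn0 => /gtn_eqF ->. Qed.

Lemma gap_weightn k0 n : gap_weight k0 n n = 0.
Proof. by rewrite /gap_weight ltnn andbF. Qed.

Lemma max_comb_gap_coef k0 n : (0 < k0)%N ->
  max_comb X (gap_coef k0 (n := n)) =
  fun w => \sum_(i < n) gap_weight k0 n i * Zgap X i w.
Proof.
move=> k0_gt0; apply/funext => w.
by rewrite /max_comb abel_Zgap gap_weight0// gap_weightn !mul0r subr0 addr0.
Qed.

Lemma sum_gap_support k0 n (f : nat -> R) : (k0 <= n)%N ->
  (forall i, ~~ (k0 <= i < n)%N -> f i = 0) ->
  \sum_(i < n) f i = \sum_(k0 <= i < n) f i.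
Proof.
move=> k0n f0; rewrite -(big_mkord xpredT f) [LHS](@big_cat_nat _ _ _ k0)//=.
rewrite big_nat_cond big1 ?add0r// => i /andP[/andP[_ ik] _].
by rewrite f0// leqNgt ik.
Qed.

(** The coefficients telescope to zero. Written with gaps, the mean is the sum of the products of
    weights and mean gaps, that is, of 1/(kH), which equals one. *)
Lemma unbiased_gap_coef k0 n : (0 < k0)%N -> (k0 <= n)%N ->
  0 < harmonic_tail R k0 n -> (forall k, (0 < k)%N -> 0 < m k) ->
  unbiased_th2 P X (gap_coef k0 (n := n)).
Proof.
move=> k0_gt0 k0n H0 m0; apply/unbiased_th2P => //; split.
  rewrite -(big_mkord xpredT (fun i => gap_weight k0 n i - gap_weight k0 n i.+1)).
  under eq_bigr do rewrite -opprB.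
  by rewrite sumrN telescope_sumr// gap_weight0// gap_weightn subr0 oppr0.
(* The mean of the same estimator is computed twice, through the maxima and through the gaps, and
   the two values are identified. *)
have := expectation_lincomb (index_enum 'I_n) (gap_coef k0 (n := n))
  (fun i : 'I_n => Lfun2_pmax i.+1 X2).
have := expectation_lincomb (index_enum 'I_n) (fun i : 'I_n => gap_weight k0 n i)
  (fun i : 'I_n => Zgap_Lfun2 i).
rewrite -[X in ('E_P[X])%E](max_comb_gap_coef n k0_gt0) => -> [<-].
rewrite (@sum_gap_support k0 n (fun i => gap_weight k0 n i * m i))//;
  last first.
  by move=> i /negbTE ki; rewrite /gap_weight ki mul0r.
transitivity (\sum_(k0 <= i < n) i%:R^-1 * (harmonic_tail R k0 n)^-1).
  apply: eq_big_nat => i /[dup] ki /andP[k0i _]; rewrite /gap_weight ki.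
  have i0 : (0 < i)%N by exact: leq_trans k0i.
  by field; rewrite !gt_eqF ?ltr0n ?m0.
by rewrite -mulr_suml divff ?gt_eqF.
Qed.

Lemma variance_gap_coef_le k0 n C : (0 < k0)%N -> (k0 <= n)%N ->
  0 < harmonic_tail R k0 n -> (forall k, (0 < k)%N -> 0 < m k) ->
  NCP P X ->
  (forall k, (k0 <= k)%N ->
    fine 'E_P[fun w => (Zgap X k w ^+ 2)%R] / (k%:R * m k ^+ 2) <= C) ->
  ('V_P[max_comb X (gap_coef k0 (n := n))] <= (C / harmonic_tail R k0 n)%:E)%E.
Proof.
move=> k0_gt0 k0n H0 m0 ncp ZC; rewrite max_comb_gap_coef// /variance.
rewrite (covariance_lincomb _ _ _ _ (fun i : 'I_n => Zgap_Lfun2 i)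
  (fun i : 'I_n => Zgap_Lfun2 i)) lee_fin.
set b := gap_weight k0 n; set H := harmonic_tail R k0 n.
have b0 i : 0 <= b i.
  rewrite /b /gap_weight; case: ifP => // /andP[k0i _].
  have i0 : (0 < i)%N by exact: leq_trans k0i.
  by rewrite invr_ge0 !mulr_ge0// ltW// m0.
(* Off the diagonal, nonnegative weights meet nonpositive covariances, so only the variances
   remain. *)
apply: (@le_trans _ _ (\sum_(i < n) b i ^+ 2 * fine 'V_P[Zgap X i])).
  apply: ler_sum => i _; rewrite (bigD1 i)//= -expr2 gerDl.
  apply: sumr_le0 => j ji.
  have [i0|i0] := posnP i; first by rewrite i0 /b gap_weight0// !mul0r.
  have [j0|j0] := posnP j; first by rewrite j0 /b gap_weight0// mulr0 mul0r.
  rewrite mulr_ge0_le0 ?mulr_ge0// fine_le0//.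
  by apply: ncp => //; rewrite eq_sym.
rewrite (@sum_gap_support k0 n (fun i => b i ^+ 2 * fine 'V_P[Zgap X i]))//; last first.
  by move=> i /negbTE ki; rewrite /b /gap_weight ki expr0n mul0r.
apply: (@le_trans _ _ (\sum_(k0 <= i < n) i%:R^-1 * (C / H ^+ 2))); last first.
  rewrite -mulr_suml -/(harmonic_tail R k0 n) -/H le_eqVlt; apply/orP; left.
  by apply/eqP; field; rewrite gt_eqF.
apply: ler_sum_nat => i /[dup] ki /andP[k0i _].
have i0 : (0 < i)%N by exact: leq_trans k0i.
have iR0 : 0 < i%:R :> R by rewrite ltr0n.
have mi0 := m0 _ i0.
apply: (le_trans (ler_wpM2l (sqr_ge0 _) (fine_variance_le_sqr (Zgap_Lfun2 i)))).
(* Isolates the ratio bounded by [C]; the squared mean gap comes from the square of the weight,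
   which also leaves one factor 1/i. *)
set q := fine _; have -> : b i ^+ 2 * q = i%:R^-1 * (q / (i%:R * m i ^+ 2) / H ^+ 2).
  by rewrite /b /gap_weight ki -/H; field; rewrite !gt_eqF.
by rewrite ler_pM2l ?invr_gt0// ler_pM2r ?invr_gt0 ?exprn_gt0// ZC.
Qed.

End gap_weights.

(** * Comparison of the BLUE with the gap estimator *)

Theorem theorem5p1 (d : measure_display) (T : measurableType d) (R : realType)
  (P : probability T R) (X : nat -> T -> R) (F : R -> R) :
  iid_with_cdf P X F ->
  ~ degenerate F ->
  ('E_P[(fun w => (X 0%N w ^+ 2)%R)] < +oo)%E ->
  NCP P X ->
  (exists (C : R) (k0 : nat), (0 < k0)%N /\
     forall k : nat, (k0 <= k)%N ->
       fine 'E_P[(fun w => (Zgap X k w ^+ 2)%R)] /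
         (k%:R * fine 'E_P[Zgap X k] ^+ 2) <= C) ->
  forall th1 th2 : R, 0 < th2 ->
  exists (K : R) (N : nat), forall n : nat, (N <= n)%N ->
    (exists c : 'I_n -> R, BLUE_th2 P X c) /\
    (forall c : 'I_n -> R, BLUE_th2 P X c ->
       ('V_P[lin_est X th1 th2 c] <= (K / ln n%:R)%:E)%E).
Proof.
move=> iid ndF EX2 ncp [C [k0 [k0_gt0 ZC]]] th1 th2 th20.
have X2 := iid_Lfun2 iid EX2.
have F01 : exists x, 0 < F x < 1.
  have [mX XF _] := iid.
  pose Y : {RV P >-> R} :=
    HB.pack (X 0%N) (isMeasurableFun.Build _ _ _ _ _ (mX 0%N)).
  apply: (@nondegenerate_cdf _ _ _ P Y) => // x.
  rewrite /cdf /distribution /pushforward -(XF 0%N x) /=.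
  have -> // : X 0%N @^-1` `]-oo, x] = [set w | X 0%N w <= x].
  by apply/seteqP; split => w; rewrite /= in_itv.
have m0 k : (0 < k)%N -> 0 < fine 'E_P[Zgap X k].
  exact: (expectation_Zgap_gt0 iid).
(* The sign of [C] is read off the hypothesis at [k0]; it is used to replace the harmonic sum in the
   denominator by its lower bound. *)
have C0 : 0 <= C.
  apply: le_trans (ZC _ (leqnn k0)); apply: divr_ge0.
    by rewrite fine_ge0// expectation_ge0// => w; rewrite sqr_ge0.
  by apply: mulr_ge0; rewrite ?ler0n ?sqr_ge0.
(* The factor 2 comes from bounding the harmonic sum below by half of ln n, valid once n is at least
   the square of [k0]; adding 2 ensures ln n > 0. *)
exists (2 * C * th2 ^+ 2), (k0 ^ 2 + 2)%N => n nN.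
have k0n2 : (k0 ^ 2 <= n)%N by apply: leq_trans nN; rewrite leq_addr.
have k0n : (k0 <= n)%N.
  by apply: leq_trans k0n2; rewrite -{1}(expn1 k0) leq_pexp2l.
have ln0 : 0 < ln (n%:R : R).
  by apply: ln_gt0; rewrite ltr1n (leq_trans _ nN)// leq_addl.
have lnH := half_ln_le_harmonic_tail R k0_gt0 k0n2.
have H0 : 0 < harmonic_tail R k0 n by apply: lt_le_trans lnH; rewrite divr_gt0.
have gapU := unbiased_gap_coef X2 k0_gt0 k0n H0 m0.
split; first exact: BLUE_th2_exists gapU.
move=> c [_ cmin]; apply: (le_trans (cmin _ gapU th1 th2 th20)).
rewrite variance_lin_est//.
apply: (le_trans (lee_wpmul2l _
  (variance_gap_coef_le X2 k0_gt0 k0n H0 m0 ncp ZC))).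
  by rewrite lee_fin sqr_ge0.
rewrite -EFinM lee_fin (_ : _ / ln n%:R = th2 ^+ 2 * (C / (ln n%:R / 2))).
  rewrite ler_wpM2l ?sqr_ge0// ler_wpM2l// lef_pV2 ?posrE ?divr_gt0//.
by field; rewrite gt_eqF.
Qed.
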